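(* Let $A\in \mathbb{R}^{n\times n}$, $p\in [n]$, $\omega=p/n$, let $L=A\otimes_\omega \overline{D}_p$ and $U=A\otimes_\omega(-\overline{D}_p)^\top$, and let $l=\max\{L(1,1),\ldots,L(n,n)\}$ and $u=\min\{U(1,1),\ldots,U(n,n)\}$. Furthermore, define $P=A+\overline{D}_p^\top$ and $Q=A-\overline{D}_p$. Then any $(i,j)\in[n]\times[n]$ that satisfies $P(i,j)>u$ or $Q(i,j)<l$ is inactive with respect to $\omega$ and any $x\in E_p(A)$.
   Context: Notation: $[n]=\{1,\dots,n\}$. For $\omega=p/n$, $p\in[n]$, $A\in\mathbb{R}^{n\times n}$ and $x\in\mathbb{R}^n$, the vector $A\otimes_\omega x$ has $i$-th entry equal to the $p$-th smallest element (counted with multiplicity) of the multiset $\{A(i,1)+x_1,\dots,A(i,n)+x_n\}$; for a matrix $B$, $A\otimes_\omega B$ is obtained by applying this to each column of $B$. Thus $L(i,j)$ is the $p$-th smallest of $\{A(i,k)+\overline{D}_p(k,j):k\in[n]\}$ and $U(i,j)$ is the $p$-th smallest of $\{A(i,k)-\overline{D}_p(j,k):k\in[n]\}$. The sums and differences defining $P,Q$ are ordinary entrywise ones. A maxmin-$\omega$ eigenvalue of $A$ is a $\lambda_p\in\mathbb{R}$ such that $A\otimes_\omega x=\lambda_p+x$ (entrywise addition of the scalar) for some $x\in\mathbb{R}^n$; it exists and is unique for each $A$ and $p$. $E_p(A)$ is the set of all $x\in\mathbb{R}^n$ with $A\otimes_\omega x=\lambda_p+x$. An entry $(i,j)$ is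 called active for $A$ with respect to $x$ and $\omega$ if $(A\otimes_\omega x)_i=A(i,j)+x_j$, and inactive otherwise. For $D\in(\mathbb{R}\cup\{-\infty\})^{n\times n}$ and real row vectors $a,b$ of length $n$, put $$\mathtt{MinMaxValue}(D,a,b\mid p,n+1-p)=\min_{S_1,S_2}\ \max_{i\in S_1,\,j\in S_2}\bigl(D(i,j)+a_i-b_j\bigr),$$ where $S_1$ ranges over all $p$-element subsets and $S_2$ over all $(n+1-p)$-element subsets of $[n]$. The sequence $\{D_p^k\}_{k\ge0}$ is defined by $D_p^0=I_n$ (the max-plus identity: zero diagonal, $-\infty$ off the diagonal) and $D_p^{k+1}(i,j)=\mathtt{MinMaxValue}(D_p^k,A_i,A_j\mid p,n+1-p)$ for all $i,j\in[n]$, where $A_i$ denotes the $i$-th row of $A$. The entrywise limit $\overline{D}_p=\lim_{k\to\infty}D_p^k$ exists (the sequence is entrywise nondecreasing and bounded above, with finite entries for $k\ge1$). *)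

(* Defs.v *)
From HB Require Import structures.
From mathcomp Require Import all_boot all_order all_algebra.
From mathcomp Require Import all_classical all_reals all_analysis.
Set Implicit Arguments.
Unset Strict Implicit.
Unset Printing Implicit Defensive.
Import Order.TTheory GRing.Theory Num.Theory.
Import numFieldNormedType.Exports.

Local Open Scope classical_set_scope.
Local Open Scope ring_scope.

(* Meaningful for 1 <= p <= size s; repeated values are counted repeatedly. *)
Definition pth_smallest (R : realType) (p : nat) (s : seq R) : R :=
  nth 0 (sort <=%R s) p.-1.

(* A (x)_omega B with omega = p / n; vectors are the case m = 1. *)
Definition maxmin_mul (R : realType) (n m : nat) (p : nat)
    (A : 'M[R]_n) (B : 'M[R]_(n, m)) : 'M[R]_(n, m) :=
  \matrix_(i, j) pth_smallest p [seq A i k + B k j | k <- enum 'I_n].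

Definition maxmin_eigenvalue (R : realType) (n : nat) (p : nat)
    (A : 'M[R]_n) (lambda : R) : Prop :=
  exists x : 'cV[R]_n, maxmin_mul p A x = const_mx lambda + x.

Definition maxmin_eigenspace (R : realType) (n : nat) (p : nat)
    (A : 'M[R]_n) (lambda : R) : set 'cV[R]_n :=
  [set x | maxmin_mul p A x = const_mx lambda + x].

Definition active (R : realType) (n : nat) (p : nat)
    (A : 'M[R]_n) (x : 'cV[R]_n) (i j : 'I_n) : Prop :=
  maxmin_mul p A x i 0 = A i j + x j 0.

Definition inactive (R : realType) (n : nat) (p : nat)
    (A : 'M[R]_n) (x : 'cV[R]_n) (i j : 'I_n) : Prop :=
  ~ active p A x i j.

(* The entries of D are meant to lie in R u {-oo}; +oo and -oo are otherwise
   only the neutral elements of the min and max. *)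
Definition MinMaxValue (R : realType) (n : nat)
    (D : 'M[\bar R]_n) (a b : 'rV[R]_n) (p q : nat) : \bar R :=
  \big[mine/+oo%E]_(S1 : {set 'I_n} | #|S1| == p)
    \big[mine/+oo%E]_(S2 : {set 'I_n} | #|S2| == q)
      \big[maxe/-oo%E]_(i in S1) \big[maxe/-oo%E]_(j in S2)
        (D i j + (a 0 i - b 0 j)%:E)%E.

Definition maxplus_id (R : realType) (n : nat) : 'M[\bar R]_n :=
  \matrix_(i, j) (if i == j then 0%E else -oo%E).

Fixpoint Dseq (R : realType) (n : nat) (p : nat) (A : 'M[R]_n) (k : nat)
    : 'M[\bar R]_n :=
  match k with
  | 0%N => maxplus_id R n
  | k'.+1 =>
      \matrix_(i, j)
        MinMaxValue (Dseq p A k') (row i A) (row j A) p (n.+1 - p)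
  end.

(* For 1 <= p <= n the limits exist and are finite, so fine loses nothing. *)
Definition Dbar (R : realType) (n : nat) (p : nat) (A : 'M[R]_n) : 'M[R]_n :=
  \matrix_(i, j) fine (limn (fun k : nat => Dseq p A k i j)).

(* Extended-real valued only to have a neutral element: finite for n >= 1. *)
Definition max_diag (R : realType) (n : nat) (M : 'M[R]_n) : \bar R :=
  \big[maxe/-oo%E]_(i < n) (M i i)%:E.

Definition min_diag (R : realType) (n : nat) (M : 'M[R]_n) : \bar R :=
  \big[mine/+oo%E]_(i < n) (M i i)%:E.

(* Main.v *)
Require Import Defs.
From HB Require Import structures.
From mathcomp Require Import all_boot all_order all_algebra.
From mathcomp Require Import all_classical all_reals all_analysis.
From mathcomp Require Import lra.
Set Implicit Arguments.
Unset Strict Implicit.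
Unset Printing Implicit Defensive.
Import Order.TTheory GRing.Theory Num.Theory.
Import numFieldNormedType.Exports.
Local Open Scope classical_set_scope.
Local Open Scope ring_scope.

(** Every eigenvector x satisfies D_p^k(i,j) <= x_i - x_j for all k, by
    induction on k: in the min-max defining D_p^{k+1}(i,j), take for S1 the
    positions of the p smallest A(i,s) + x_s and for S2 those of the n+1-p
    largest A(j,t) + x_t.  Hence Dbar(i,j) <= x_i - x_j, which yields
    l <= lambda <= u, while an active entry (i,j), for which
    A(i,j) = lambda + x_i - x_j, has P(i,j) <= lambda <= Q(i,j). *)

(** Pigeonhole: the two sizes add up to n + 1, too many for disjoint subsets of [n]. *)
Lemma card_ord_meet (n p : nat) (S1 S2 : {set 'I_n}) :
  (p <= n)%N -> #|S1| = p -> #|S2| = (n.+1 - p)%N ->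
  exists2 k, k \in S1 & k \in S2.
Proof.
move=> pn c1 c2; have [S0|[k]] := set_0Vmem (S1 :&: S2); last first.
  by rewrite inE => /andP[]; exists k.
have := max_card (mem (S1 :|: S2)); have := cardsUI S1 S2.
by rewrite S0 cards0 addn0 c1 c2 card_ord subnKC 1?leqW// => ->; rewrite ltnn.
Qed.

Section PthSmallest.
Variables (R : realType) (n p : nat).
Hypothesis hp : (1 <= p <= n)%N.
Implicit Types f g : 'I_n -> R.

Let pth f := pth_smallest p [seq f k | k <- enum 'I_n].

(** Indices are sorted instead of values, so that tied values keep distinct indices and every
    segment of the list gives a set of known size. *)
Let sorted_enum f := sort (relpre f <=%R) (enum 'I_n).

Let size_sorted_enum f : size (sorted_enum f) = n.
Proof. by rewrite size_sort size_enum_ord. Qed.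

Let nth_sorted_enum f x0 m m' : (m <= m' < n)%N ->
  f (nth x0 (sorted_enum f) m) <= f (nth x0 (sorted_enum f) m').
Proof.
move=> /andP[mm' m'n].
apply: (@sorted_leq_nth _ (relpre f <=%R)) => //=.
- by move=> y x z /=; apply: le_trans.
- by move=> y; apply: lexx.
- by apply: (@sort_sorted _ (relpre f <=%R)) => x y; apply: le_total.
- by rewrite inE size_sorted_enum (leq_ltn_trans mm').
- by rewrite inE size_sorted_enum.
Qed.

Let pthE f x0 : pth f = f (nth x0 (sorted_enum f) p.-1).
Proof.
case/andP: hp => p0 pn.
by rewrite /pth /pth_smallest sort_map (nth_map x0)// size_sorted_enum prednK.
Qed.

Lemma pth_smallest_lower f : exists2 S : {set 'I_n},
  #|S| = p & forall k, k \in S -> f k <= pth f.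
Proof.
case/andP: hp => p0 pn; have x0 : 'I_n := Ordinal (leq_trans p0 pn).
exists [set k in take p (sorted_enum f)].
  rewrite cardsE (card_uniqP _) ?size_takel ?size_sorted_enum//.
  by rewrite take_uniq// sort_uniq enum_uniq.
move=> k; rewrite inE => /(nthP x0)[m]; rewrite size_takel ?size_sorted_enum//.
move=> mp <-; rewrite nth_take// (pthE f x0) nth_sorted_enum//.
by rewrite -ltnS prednK// mp.
Qed.

Lemma pth_smallest_upper f : exists2 S : {set 'I_n},
  #|S| = (n.+1 - p)%N & forall k, k \in S -> pth f <= f k.
Proof.
case/andP: hp => p0 pn; have x0 : 'I_n := Ordinal (leq_trans p0 pn).
(* Dropping [p.-1] indices rather than [p] keeps the position of the p-th smallest value itself,
   whence the size n + 1 - p. *)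
exists [set k in drop p.-1 (sorted_enum f)].
  rewrite cardsE (card_uniqP _) ?size_drop ?size_sorted_enum//.
    by rewrite -{2}(prednK p0) subSS.
  by rewrite drop_uniq// sort_uniq enum_uniq.
move=> k; rewrite inE => /(nthP x0)[m]; rewrite size_drop size_sorted_enum.
move=> mp <-; rewrite nth_drop (pthE f x0) nth_sorted_enum//.
by rewrite leq_addr/= -ltn_subRL.
Qed.

(** A lower set of [g] and an upper set of [f] share an index k, and there pth f <= f k <= g k + c
    <= pth g + c. *)
Lemma pth_smallest_leD f g c : (forall k, f k <= g k + c) -> pth f <= pth g + c.
Proof.
move=> fg; have [S1 c1 h1] := pth_smallest_lower g.
have [S2 c2 h2] := pth_smallest_upper f; case/andP: hp => _ pn.
have [k k1 k2] := card_ord_meet pn c1 c2.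
by rewrite (le_trans (h2 k k2))// (le_trans (fg k))// lerD2r h1.
Qed.

End PthSmallest.

Section MinMax.
Variables (R : realType) (n : nat).
Implicit Types (D : 'M[\bar R]_n) (a b : 'rV[R]_n).
Local Open Scope ereal_scope.

Lemma MinMaxValue_mono D D' a b p q : (forall i j, D i j <= D' i j) ->
  MinMaxValue D a b p q <= MinMaxValue D' a b p q.
Proof.
move=> DD'; apply: le_bigmin2 => S1 _; apply: le_bigmin2 => S2 _.
apply: le_bigmax2 => i _; apply: le_bigmax2 => j _.
by rewrite leeD2r.
Qed.

Lemma MinMaxValue_le D a b (S1 S2 : {set 'I_n}) v :
  (forall i j, i \in S1 -> j \in S2 -> D i j + (a 0%R i - b 0%R j)%:E <= v) ->
  MinMaxValue D a b #|S1| #|S2| <= v.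
Proof.
move=> Dv; apply: (bigmin_inf S1) => //; apply: (bigmin_inf S2) => //.
by do 2![apply: bigmax_le => [|? ?]; first exact: leNye]; apply: Dv.
Qed.

(* The index sets of the min-max necessarily meet, so diagonal entries of D
   bound it from below. *)
Lemma MinMaxValue_ge D a b p v : (p <= n)%N ->
  (forall k, v <= D k k + (a 0%R k - b 0%R k)%:E) ->
  v <= MinMaxValue D a b p (n.+1 - p).
Proof.
move=> pn vD; apply: le_bigmin => [|S1 /eqP c1]; first exact: leey.
apply: le_bigmin => [|S2 /eqP c2]; first exact: leey.
have [k k1 k2] := card_ord_meet pn c1 c2.
by apply: (bigmax_sup k) => //; apply: (bigmax_sup k).
Qed.

End MinMax.

Section Dseq.
Variables (R : realType) (n p : nat) (A : 'M[R]_n).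
Hypothesis hp : (1 <= p <= n)%N.
Local Open Scope ereal_scope.

(** Monotonicity of the min-max propagates the first step D^0 <= D^1. That step only concerns the
    diagonal, where the two rows coincide and each meeting index contributes 0. *)
Lemma Dseq_nondecreasing i j :
  {homo (fun k => Dseq p A k i j) : k m / (k <= m)%N >-> k <= m}.
Proof.
case/andP: hp => _ pn.
apply: homo_leq => [x||k]; [exact: lexx|exact: le_trans|].
elim: k i j => [|k IH] i j /=; rewrite !mxE; last exact: MinMaxValue_mono.
case: eqVneq => [->|_]; last exact: leNye.
apply: MinMaxValue_ge => // k.
by rewrite !mxE eqxx subrr adde0.
Qed.

(** Keeps the limit away from -oo, which [fine] would turn into 0. *)
Lemma Dseq1_gtNy i j : -oo < Dseq p A 1 i j.
Proof.
case/andP: hp => _ pn.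
(* The default 0 of this minimum can only lower [c], which remains a lower bound. *)
pose c := (\big[Num.min/0]_k (A i k - A j k))%R.
apply: (@lt_le_trans _ _ c%:E); first exact: ltNyr.
rewrite /= mxE; apply: MinMaxValue_ge => // k.
by rewrite !mxE eqxx add0e lee_fin bigmin_le_cond.
Qed.

Variables (lambda : R) (x : 'cV[R]_n).
Hypothesis xE : maxmin_eigenspace p A lambda x.

Lemma eigenspaceE i :
  pth_smallest p [seq (A i k + x k 0)%R | k <- enum 'I_n] = (lambda + x i 0)%R.
Proof. by have := congr1 (fun M : 'cV_n => M i 0%R) xE; rewrite !mxE. Qed.

Lemma Dseq_le_eigenvector k i j : Dseq p A k i j <= (x i 0 - x j 0)%:E.
Proof.
elim: k i j => [|k IH] i j /=; rewrite mxE.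
  by case: eqVneq => [->|_]; rewrite ?subrr ?leNye.
have [S1 c1 h1] := pth_smallest_lower hp (fun k => A i k + x k 0)%R.
have [S2 c2 h2] := pth_smallest_upper hp (fun k => A j k + x k 0)%R.
(* Only the size argument is rewritten, since [p] also occurs inside [Dseq]. *)
rewrite -c2 -[X in MinMaxValue _ _ _ X]c1.
apply: MinMaxValue_le => s t /h1 + /h2; rewrite !eigenspaceE !mxE => hs ht.
(* Subtracting lambda + x_j <= A(j,t) + x_t from A(i,s) + x_s <= lambda + x_i eliminates lambda. *)
apply: (le_trans (leeD2r _ (IH s t))); rewrite -EFinD lee_fin.
by move: hs ht; lra.
Qed.

Lemma Dbar_le_eigenvector i j : (Dbar p A i j <= x i 0 - x j 0)%R.
Proof.
rewrite mxE (cvg_lim _ (ereal_nondecreasing_cvgn (@Dseq_nondecreasing i j)))//.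
(* The limit is now a supremum; bounding it on both sides makes it finite, so that [fine] preserves
   the inequality. *)
set s := ereal_sup _.
have sle : s <= (x i 0 - x j 0)%:E.
  by apply: ge_ereal_sup => _ [k _ <-]; apply: Dseq_le_eigenvector.
have sgt : -oo < s.
  by apply: lt_le_trans (Dseq1_gtNy i j) _; apply: ereal_sup_ubound; exists 1%N.
by rewrite -lee_fin fineK// fin_numElt sgt (le_lt_trans sle (ltry _)).
Qed.

End Dseq.

Theorem proposition3p20 (R : realType) (n p : nat) (hp : (1 <= p <= n)%N)
    (A : 'M[R]_n) :
  let L := maxmin_mul p A (Dbar p A) in
  let U := maxmin_mul p A (- Dbar p A)^T in
  let l := max_diag L in
  let u := min_diag U in
  let P := A + (Dbar p A)^T in
  let Q := A - Dbar p A in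
  forall i j : 'I_n,
    (u < (P i j)%:E)%E \/ ((Q i j)%:E < l)%E ->
    forall lambda : R, maxmin_eigenvalue p A lambda ->
    forall x : 'cV[R]_n, maxmin_eigenspace p A lambda x ->
    inactive p A x i j.
Proof.
move=> L U l u P Q i j hij lambda _ x xE act.
have Dx := Dbar_le_eigenvector hp xE.
have {}act : lambda + x i 0 = A i j + x j 0.
  by rewrite -act /maxmin_mul mxE (eigenspaceE xE).
have l_le : (l <= lambda%:E)%E.
  apply: bigmax_le => [|k _]; first exact: leNye.
  (* Writing lambda as (lambda + x_k) - x_k turns the goal into a comparison of two p-th smallest
     values with shift -x_k. *)
  rewrite lee_fin mxE -[leRHS](addrK (x k 0)) -(eigenspaceE xE).
  by apply: pth_smallest_leD => // m; rewrite -addrA lerD2l.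
have le_u : (lambda%:E <= u)%E.
  apply: le_bigmin => [|k _]; first exact: leey.
  (* Here x_k is added to both sides, so the shift is +x_k and the bound on Dbar(k,m) applies with
     its sign reversed. *)
  rewrite lee_fin mxE -(lerD2r (x k 0)) -(eigenspaceE xE).
  apply: pth_smallest_leD => // m; rewrite 2!mxE -addrA lerD2l.
  by have := Dx k m; lra.
have Dij := Dx i j; have Dji := Dx j i.
case: hij; apply/negP; rewrite -leNgt.
  apply: le_trans le_u; rewrite lee_fin !mxE; move: Dji act; rewrite mxE; lra.
apply: (le_trans l_le); rewrite lee_fin !mxE; move: Dij act; rewrite mxE; lra.
Qed.
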